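(* Consider a Jackson network in a random environment with rerouting by randomized reflection (setting in the context), where the extended routing matrix $r$ is reversible for $\eta$, and let $\mathbf{Z}=(\mathbf{X},\mathbf{Y})$ be the Markov process on $E=\mathbb{N}_0^{\overline{J}}\times K$ with positive transition rates, for $(\mathbf{n},k)\in E$, $q((\mathbf{n},k),(\mathbf{n}+\mathbf{e}_i,k))=\beta(k)\lambda r^{(\boldsymbol{\alpha}(k))}(0,i)$ ($i\in\overline{J}$); $q((\mathbf{n},k),(\mathbf{n}-\mathbf{e}_j+\mathbf{e}_i,k))=1_{[n_j>0]}\gamma_j(k)\mu_j(n_j)r^{(\boldsymbol{\alpha}(k))}(j,i)$ ($i,j\in\overline{J}$, $i\ne j$); $q((\mathbf{n},k),(\mathbf{n}-\mathbf{e}_j,m))=1_{[n_j>0]}\gamma_j(k)\mu_j(n_j)r^{(\boldsymbol{\alpha}(k))}(j,0)R_j(k,m)$ ($j\in\overline{J}$, $m\in K$); $q((\mathbf{n},k),(\mathbf{n},m))=\nu(k,m)$ ($m\in K$, $m\ne k$). Assume $\mathbf{Z}$ is ergodic, and assume the pure Jackson network process (without environment) is ergodic with stationary distribution $\xi(\mathbf{n})=\prod_{j=1}^J\prod_{l=1}^{n_j}\frac{\eta_j}{\mu_j(l)}C(j)^{-1}$. Then $\mathbf{Z}$ has the unique stationary distribution \[ \pi(\mathbf{n},k)=\xi(\mathbf{n})\theta(k),\qquad \mathbf{n}\in\mathbb{N}_0^{\overline{J}},\ k\in K, \] where $\theta$ is the unique stochastic solution of $\theta\cdot Q_{red}=0$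 with \[ Q_{red}=V+\sum_{j\in\overline{J}}\eta_j\, I_{(\gamma_j\bullet r^{(\boldsymbol{\alpha}(\cdot))}(j,0))}\,(R_j-I), \] $I_{(\gamma_j\bullet r^{(\boldsymbol{\alpha}(\cdot))}(j,0))}$ denoting the diagonal matrix indexed by $K$ with diagonal entries $\gamma_j(k)\,r^{(\boldsymbol{\alpha}(k))}(j,0)$, $k\in K$.
   Context: Jackson network data: node set $\overline{J}=\{1,\dots,J\}$, extended node set $\overline{J}_0=\{0,\dots,J\}$; external arrival rates $\lambda_j\ge0$, $\lambda=\sum_j\lambda_j>0$; service intensities $\mu_j(n)>0$, $n\ge1$; extended routing matrix $r$ on $\overline{J}_0$ stochastic, irreducible, $r(0,j)=\lambda_j/\lambda$, $r(0,0)=0$; $\eta=(\eta_j:j\in\overline{J}_0)$ with $\eta_0=\lambda$ solves $\eta_j=\sum_{i\in\overline{J}_0}\eta_i r(i,j)$; reversibility means $\eta_ir(i,j)=\eta_jr(j,i)$ for all $i,j$. The pure Jackson network process is the Markov chain on $\mathbb{N}_0^{\overline{J}}$ with rates $\lambda r(0,i)$ ($\mathbf{n}\to\mathbf{n}+\mathbf{e}_i$), $1_{[n_j>0]}\mu_j(n_j)r(j,i)$ ($\mathbf{n}\to\mathbf{n}-\mathbf{e}_j+\mathbf{e}_i$, $i\ne j$), $1_{[n_j>0]}\mu_j(n_j)r(j,0)$ ($\mathbf{n}\to\mathbf{n}-\mathbf{e}_j$), and $C(j)=\sum_{n\ge0}\prod_{l=1}^n\eta_j/\mu_j(l)$. Environment: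 countable state space $K$; $V=(\nu(k,m):k,m\in K)$ is a generator matrix ($\nu(k,m)\ge0$ for $k\ne m$, $\nu(k,k)=-\sum_{m\ne k}\nu(k,m)$); $R_j$, $j\in\overline{J}$, are stochastic matrices on $K$; $I$ is the identity on $K$. For each $k\in K$ there is $\boldsymbol{\gamma}(k)\in[0,\infty)^{\overline{J}}$. Define $\alpha_0(k)=1$, $\alpha_j(k)=\gamma_j(k)$ if $\|\boldsymbol{\gamma}(k)\|_\infty\le1$ and $\alpha_j(k)=\gamma_j(k)/\|\boldsymbol{\gamma}(k)\|_\infty$ otherwise; $\beta(k)=1$ if $\|\boldsymbol{\gamma}(k)\|_\infty\le1$ and $\beta(k)=\|\boldsymbol{\gamma}(k)\|_\infty$ otherwise. $r^{(\boldsymbol{\alpha}(k))}$ is the randomized-reflection modification of $r$: $r^{(\boldsymbol{\alpha}(k))}(i,j)=r(i,j)\alpha_j(k)$ for $i\ne j$, $r^{(\boldsymbol{\alpha}(k))}(i,i)=1-\sum_{j\ne i}r(i,j)\alpha_j(k)$. *)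

(* Defs.v *)
From HB Require Import structures.
From mathcomp Require Import all_boot all_order all_algebra.
From mathcomp Require Import all_classical all_reals all_analysis.
From Stdlib Require Import Relations.
Set Implicit Arguments. Unset Strict Implicit. Unset Printing Implicit Defensive.
Import Order.TTheory GRing.Theory Num.Theory.
Local Open Scope ring_scope.
Local Open Scope classical_set_scope.

(* Continuous-time Markov chains on a countable state space S, given  *)
(* by their off-diagonal transition rates q x y (x <> y).             *)
Section Chains.
Variables (R : realType) (S : countType) (q : S -> S -> R).

Definition out_rate (x : S) : \bar R :=
  \esum_(y in [set y | y != x]) (q x y)%:E.

Definition stable_chain : Prop := forall x, (out_rate x < +oo)%E.

Definition irreducible_chain : Prop :=
  forall x y, clos_refl_trans S (fun a b => a != b /\ 0 < q a b) x y.

(* non-explosion (regularity), via Reuter's criterion: the only bounded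
   nonnegative solution of Q f = f is f = 0 *)
Definition non_explosive : Prop :=
  forall f : S -> R, (forall x, 0 <= f x) -> (exists M, forall x, f x <= M) ->
   (forall x, \esum_(y in [set y | y != x]) (q x y * f y)%:E
              = ((1%:E + out_rate x) * (f x)%:E)%E) ->
   forall x, f x = 0.

Definition is_distribution (p : S -> R) : Prop :=
  (forall x, 0 <= p x) /\ \esum_(x in [set: S]) (p x)%:E = 1%E.

Definition is_stationary (p : S -> R) : Prop :=
  is_distribution p /\
  forall x, \esum_(y in [set y | y != x]) (p y * q y x)%:E = ((p x)%:E * out_rate x)%E.

(* ergodic = stable, irreducible, non-explosive and positive recurrent;
   for such chains positive recurrence is equivalent to the existence of
   an invariant distribution (Norris, Thm 3.5.3). *)
Definition ergodic_chain : Prop :=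
  [/\ stable_chain, irreducible_chain, non_explosive & exists p, is_stationary p].

End Chains.

(* Jackson networks. Nodes 1..J are represented by 'I_J; the extended  *)
(* node set {0,...,J} by option 'I_J, with None = node 0 (outside).    *)
Section Jackson.
Variables (R : realType) (J : nat).

Definition addv (n : {ffun 'I_J -> nat}) (i : 'I_J) : {ffun 'I_J -> nat} :=
  [ffun l => (n l + (l == i))%N].
Definition subv (n : {ffun 'I_J -> nat}) (j : 'I_J) : {ffun 'I_J -> nat} :=
  [ffun l => (n l - (l == j))%N].

Definition jackson_rate (lam : R) (r : option 'I_J -> option 'I_J -> R)
    (mu : 'I_J -> nat -> R) (n n' : {ffun 'I_J -> nat}) : R :=
  \sum_(i : 'I_J) (if n' == addv n i then lam * r None (Some i) else 0)
  + \sum_(j : 'I_J) \sum_(i : 'I_J)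
      (if [&& i != j, (0 < n j)%N & n' == addv (subv n j) i]
       then mu j (n j) * r (Some j) (Some i) else 0)
  + \sum_(j : 'I_J)
      (if (0 < n j)%N && (n' == subv n j)
       then mu j (n j) * r (Some j) None else 0).

(* ||g||_oo for nonnegative g *)
Definition supnorm (g : 'I_J -> R) : R := \big[Num.max/0]_(j : 'I_J) g j.

Definition alpha (g : 'I_J -> R) (i : option 'I_J) : R :=
  match i with
  | None => 1
  | Some j => if supnorm g <= 1 then g j else g j / supnorm g
  end.

Definition beta (g : 'I_J -> R) : R :=
  if supnorm g <= 1 then 1 else supnorm g.

Definition rrefl (a : option 'I_J -> R) (r : option 'I_J -> option 'I_J -> R)
    (i j : option 'I_J) : R :=
  if i == j then 1 - \sum_(l : option 'I_J | l != i) r i l * a l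
  else r i j * a j.

Variable (K : countType).

Definition env_rate (lam : R) (r : option 'I_J -> option 'I_J -> R)
    (mu : 'I_J -> nat -> R) (nu : K -> K -> R) (Rm : 'I_J -> K -> K -> R)
    (gamma : K -> 'I_J -> R)
    (x y : {ffun 'I_J -> nat} * K) : R :=
  let n := x.1 in let k := x.2 in let n' := y.1 in let m := y.2 in
  let ra := rrefl (alpha (gamma k)) r in
  (if m == k then
     \sum_(i : 'I_J) (if n' == addv n i then beta (gamma k) * lam * ra None (Some i) else 0)
     + \sum_(j : 'I_J) \sum_(i : 'I_J)
        (if [&& i != j, (0 < n j)%N & n' == addv (subv n j) i]
         then gamma k j * mu j (n j) * ra (Some j) (Some i) else 0)
   else 0)
  + \sum_(j : 'I_J)
      (if (0 < n j)%N && (n' == subv n j)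
       then gamma k j * mu j (n j) * ra (Some j) None * Rm j k m else 0)
  + (if (n' == n) && (m != k) then nu k m else 0).

Definition Qred (r : option 'I_J -> option 'I_J -> R) (eta : option 'I_J -> R)
    (nu : K -> K -> R) (Rm : 'I_J -> K -> K -> R) (gamma : K -> 'I_J -> R)
    (k m : K) : R :=
  nu k m + \sum_(j : 'I_J) eta (Some j) *
     (gamma k j * rrefl (alpha (gamma k)) r (Some j) None) *
     (Rm j k m - (k == m)%:R).

(* theta . Q = 0 for a generator-type matrix Q (nonneg off-diagonal):
   sum_{k <> m} theta(k) Q(k,m) + theta(m) Q(m,m) = 0 *)
Definition left_null (Q : K -> K -> R) (theta : K -> R) : Prop :=
  forall m, \esum_(k in [set k | k != m]) (theta k * Q k m)%:E
            = (theta m * - Q m m)%:E.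

Definition Cnorm (eta : option 'I_J -> R) (mu : 'I_J -> nat -> R) (j : 'I_J) : R :=
  limn (fun N => \sum_(0 <= n < N) \prod_(1 <= l < n.+1) (eta (Some j) / mu j l)).

Definition xi (eta : option 'I_J -> R) (mu : 'I_J -> nat -> R)
    (n : {ffun 'I_J -> nat}) : R :=
  \prod_(j : 'I_J) ((\prod_(1 <= l < (n j).+1) (eta (Some j) / mu j l))
                    / Cnorm eta mu j).

End Jackson.

(* Main.v *)
(* The product measure built from [xi] and a measure [theta] on [K] is mapped by
   the generator of Z to the product of [xi] and [theta Q_red]: by reversibility
   and [beta alpha_j = gamma_j], the flows created by the reflected routing cancel
   in pairs.  An irreducible Q_red always has a subinvariant measure [theta],
   namely a Green measure with killing in one state.  Then [xi theta] is
   subinvariant for Z.  For a non-explosive irreducible chain with stationary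
   distribution [p], every subinvariant measure [v] is a multiple of [p]: the
   measures [min v (c p)] are finite and subinvariant, finite subinvariant
   measures are invariant because no mass is lost by explosion, and invariance of
   all of them forces [v / p] to be constant.  So [theta] is finite, and this also
   yields both uniqueness claims. *)
Require Import Defs.
From HB Require Import structures.
From mathcomp Require Import all_boot all_order all_algebra.
From mathcomp Require Import all_classical all_reals all_analysis.
From mathcomp Require Import ring lra.
From Stdlib Require Import Relations.
Import Order.TTheory GRing.Theory Num.Theory.
Import numFieldNormedType.Exports.
Local Open Scope ring_scope.
Local Open Scope classical_set_scope.

Set Implicit Arguments. Unset Strict Implicit. Unset Printing Implicit Defensive.

(* The unqualified names denote other constants of MathComp. *)
Local Notation addv := Defs.addv.
Local Notation rrefl := Defs.rrefl.

Local Notation "\tsum_ x F" := (esum [set: _] (fun x => F%:E))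
  (at level 41, x name, F at level 41).

(** * Sums of nonnegative families over arbitrary index types *)

Section esum_extra.
Context {R : realType}.

Lemma esum_offdiag (T : choiceType) (x : T) (f : T -> \bar R) :
  \esum_(y in [set y | y != x]) f y = \esum_(y in [set: T]) if y == x then 0%E else f y.
Proof.
rewrite esum_mkcond; apply: eq_esum => y _; rewrite -[RHS]if_neg.
by rewrite (_ : (y \in _) = (y != x))//; apply/idP/idP; rewrite inE.
Qed.

Lemma esum_exchange (T1 T2 : choiceType) (a : T1 -> T2 -> \bar R) :
  (forall i j, 0 <= a i j)%E ->
  \esum_(i in [set: T1]) \esum_(j in [set: T2]) a i j
  = \esum_(j in [set: T2]) \esum_(i in [set: T1]) a i j.
Proof.
move=> a0; rewrite !esum_esum//.
rewrite (reindex_esum (setT `*`` (fun=> setT)) _ (fun x : T2 * T1 => (x.2, x.1)))//.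
split => //= [[i1 i2] [j1 j2] _ _ [-> ->]//|[i j] _].
by exists (j, i).
Qed.

Lemma esum_pair (T1 T2 : choiceType) (a : T1 * T2 -> \bar R) :
  (forall z, 0 <= a z)%E ->
  \esum_(z in [set: T1 * T2]) a z
  = \esum_(i in [set: T1]) \esum_(j in [set: T2]) a (i, j).
Proof.
move=> a0; rewrite esum_esum//.
rewrite (_ : _ `*`` _ = setT); last by apply/seteqP; split.
by apply: eq_esum => -[].
Qed.

Lemma esum_ge_term (T : choiceType) (f : T -> \bar R) x :
  (f x <= \esum_(y in [set: T]) f y)%E.
Proof.
by apply: esum_ge; exists [set x]; [split|rewrite fsbig_set1].
Qed.

Lemma esum_supp1 (T : choiceType) (f : T -> \bar R) x :
  (0 <= f x)%E ->
  \esum_(y in [set: T]) (if y == x then f y else 0%E) = f x.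
Proof.
move=> fx; rewrite -[RHS](@esum_set1 R T x f)// [RHS]esum_mkcond.
apply: eq_esum => y _; rewrite (_ : (y \in _) = (y == x))//.
by apply/idP/idP; rewrite inE => /eqP.
Qed.

(** The sum is a supremum over finite index sets, so real upper bounds can be tested on finite
    partial sums. *)
Lemma tsum_leP (T : choiceType) (f : T -> R) (M : R) :
  (forall s : seq T, uniq s -> \sum_(x <- s) f x <= M) <->
  (\tsum_x f x <= M%:E)%E.
Proof.
split=> [sM|fM s us].
  apply: ge_ereal_sup => _ [X [finX _] <-].
  by rewrite fsbig_finite//= sumEFin lee_fin; exact: sM.
rewrite -lee_fin -sumEFin fsbig_seq//; apply: le_trans fM.
by apply: esum_ge; exists [set` s] => //; split => //; exact: finite_seq.
Qed.

Lemma tsum_ge0 (T : choiceType) (f : T -> R) :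
  (forall x, 0 <= f x) -> (0 <= \tsum_x f x)%E.
Proof. by move=> f0; apply: esum_ge0 => x _; rewrite lee_fin. Qed.

Lemma tsum_fin_num (T : choiceType) (f : T -> R) (M : \bar R) :
  (forall x, 0 <= f x) -> (\tsum_x f x <= M)%E -> (M < +oo)%E ->
  (\tsum_x f x)%E \is a fin_num.
Proof.
move=> f0 fM Moo; rewrite fin_numElt (lt_le_trans (ltNyr 0))/=.
  exact: le_lt_trans fM Moo.
exact: tsum_ge0.
Qed.

Lemma tsum_bounded (T : choiceType) (f : T -> R) (M : R) :
  (forall x, 0 <= f x) -> (\tsum_x f x <= M%:E)%E ->
  exists v : R, (\tsum_x f x = v%:E)%E.
Proof.
move=> f0 fM; exists (fine (\tsum_x f x)%E).
by rewrite fineK// (tsum_fin_num f0 fM)// ltry.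
Qed.

(** One inequality is checked on finite sums; the other is the same inequality for the factor
    [c^-1]. The infinite cases are treated apart. *)
Lemma tsumZl (T : choiceType) (c : R) (f : T -> R) :
  0 <= c -> (forall x, 0 <= f x) ->
  (\tsum_x (c * f x) = c%:E * \tsum_x f x)%E.
Proof.
have le a (g : T -> R) M : 0 < a -> (\tsum_x g x <= M%:E)%E ->
    (\tsum_x (a * g x)%R <= (a * M)%:E)%E.
  move=> a0 /tsum_leP gM; apply/tsum_leP => s us.
  by rewrite -mulr_sumr ler_pM2l// gM.
rewrite le_eqVlt => /predU1P[<- f0|c0 f0].
  by rewrite mul0e esum1// => x _; rewrite mul0r.
have cf0 x : 0 <= c * f x by rewrite mulr_ge0// ltW.
apply/eqP; rewrite eq_le; apply/andP; split.
  have := tsum_ge0 f0; case E: (\tsum_x f x)%E => [M||]// _.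
    by apply: (le _ _ M) => //; rewrite E.
  by rewrite mulry gtr0_sg// mul1e leey.
have := tsum_ge0 cf0; case E: (\tsum_x (c * f x))%E => [M||]// _; last by rewrite leey.
have := @le c^-1 (fun x => c * f x) M; rewrite invr_gt0 c0 E => /(_ isT (lexx _)).
under eq_esum do rewrite mulKf ?gt_eqF//.
move=> fM; have c0' : (0 <= c%:E)%E by rewrite lee_fin ltW.
apply: le_trans (lee_wpmul2l c0' fM) _.
by rewrite -EFinM mulVKf ?gt_eqF.
Qed.

Lemma tsumD (T : choiceType) (f g : T -> R) :
  (forall x, 0 <= f x) -> (forall x, 0 <= g x) ->
  (\tsum_x (f x + g x) = \tsum_x f x + \tsum_x g x)%E.
Proof.
move=> f0 g0; under eq_esum do rewrite EFinD.
by rewrite esumD// => x _; rewrite lee_fin.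
Qed.

Lemma le_tsum (T : choiceType) (f g : T -> R) :
  (forall x, f x <= g x) -> (\tsum_x f x <= \tsum_x g x)%E.
Proof. by move=> fg; apply: le_esum => x _; rewrite lee_fin. Qed.

Lemma tsum_exchange (T1 T2 : choiceType) (a : T1 -> T2 -> R) (u : T1 -> R)
    (v : T2 -> R) :
  (forall i j, 0 <= a i j) ->
  (forall i, \tsum_j a i j = (u i)%:E)%E ->
  (forall j, \tsum_i a i j = (v j)%:E)%E ->
  (\tsum_i u i = \tsum_j v j)%E.
Proof.
move=> a0 hu hv.
under eq_esum do rewrite -hu.
rewrite esum_exchange; last by move=> i j; rewrite lee_fin.
by under eq_esum do rewrite hv.
Qed.

(** A form of Fatou's lemma: every finite partial sum converges, so a uniform bound passes to the
    pointwise limit. *)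
Lemma tsum_lim_le (T : choiceType) (f : nat -> T -> R) (g : T -> R) (M : R) :
  (forall x, (fun n => f n x) @ \oo --> g x) ->
  (forall n, \tsum_x f n x <= M%:E)%E -> (\tsum_x g x <= M%:E)%E.
Proof.
move=> fg fM; apply/tsum_leP => s us.
have cv : (fun n => \sum_(x <- s) f n x) @ \oo --> \sum_(x <- s) g x.
  elim: s {us} => [|x s IHs].
    by under eq_fun do rewrite big_nil; rewrite big_nil; exact: cvg_cst.
  by under eq_fun do rewrite big_cons; rewrite big_cons; exact: cvgD.
rewrite -(cvg_lim _ cv)//; apply: limr_le; first by apply/cvg_ex; eexists; exact: cv.
by apply: nearW => n; exact: (tsum_leP (f n) M).2 (fM n) s us.
Qed.

(** The nonnegative differences [g - f] have sum at most 0. *)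
Lemma tsum_eq_term (T : choiceType) (f g : T -> R) (M : R) :
  (forall x, 0 <= f x) -> (forall x, f x <= g x) ->
  (\tsum_x f x = M%:E)%E -> (\tsum_x g x <= M%:E)%E -> forall x, f x = g x.
Proof.
move=> f0 fg fM gM x.
have d0 y : 0 <= g y - f y by rewrite subr_ge0.
have : (\tsum_y (f y + (g y - f y))%R <= M%:E)%E.
  by under eq_esum do rewrite addrC subrK.
rewrite tsumD// fM -leeBrDl// subee// => d.
have := le_trans (esum_ge_term (fun y => (g y - f y)%:E) x) d.
rewrite lee_fin subr_le0 => gf; apply/eqP; rewrite eq_le fg//.
Qed.

(** Bridge from the off-diagonal sums in the definitions of chains to full sums. *)
Lemma esum_offdiag_diag0 (T : choiceType) (x : T) (f : T -> R) : f x = 0 ->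
  \esum_(y in [set y | y != x]) (f y)%:E = \tsum_y f y.
Proof.
by move=> fx; rewrite esum_offdiag; apply: eq_esum => y _; case: eqP => [->|//]; rewrite fx.
Qed.

(** Nonnegativity is bundled with the value because linearity of the sum is available only for
    nonnegative families. *)
Definition has_sum (T : choiceType) (f : T -> R) (v : R) :=
  (forall x, 0 <= f x) /\ (\tsum_x f x = v%:E)%E.

Lemma eq_has_sum (T : choiceType) (f g : T -> R) v w :
  (forall x, g x = f x) -> w = v -> has_sum f v -> has_sum g w.
Proof. by move=> /funext -> ->. Qed.

Lemma has_sumD (T : choiceType) (f g : T -> R) v w :
  has_sum f v -> has_sum g w -> has_sum (fun x => f x + g x) (v + w).
Proof.
move=> [f0 fv] [g0 gw]; split=> [x|]; first by rewrite addr_ge0.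
by rewrite tsumD// fv gw.
Qed.

Lemma has_sumZ (T : choiceType) (f : T -> R) c v :
  0 <= c -> has_sum f v -> has_sum (fun x => c * f x) (c * v).
Proof.
move=> c0 [f0 fv]; split=> [x|]; first by rewrite mulr_ge0.
by rewrite tsumZl// fv.
Qed.

Lemma has_sum_le (T : choiceType) (f g : T -> R) v :
  (forall x, 0 <= f x) -> (forall x, f x <= g x) -> has_sum g v -> exists w, has_sum f w.
Proof.
move=> f0 fg [g0 gv]; have [|w hw] := tsum_bounded (M := v) f0; last by exists w.
by rewrite -gv; exact: le_tsum.
Qed.

Lemma has_sum_sum (T : choiceType) (I : finType) (f : I -> T -> R) (v : I -> R) :
  (forall i, has_sum (f i) (v i)) -> has_sum (fun x => \sum_i f i x) (\sum_i v i).
Proof.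
move=> fv; have f0 i x : 0 <= f i x by case: (fv i).
split=> [x|]; first by rewrite sumr_ge0.
under eq_esum do rewrite -sumEFin.
rewrite esum_sum => [|*]; last by rewrite lee_fin.
by rewrite -sumEFin; apply: eq_bigr => i _; case: (fv i).
Qed.

(** Each kind of transition of Z fixes the network component [a] of the other endpoint and leaves
    only the environment to sum over; [P] is the condition under which the transition is
    possible. *)
Lemma has_sum_slice (T1 T2 : choiceType) (P : bool) (a : T1) (c : R) (u : T2 -> R) (U : R) :
  (P -> 0 <= c) -> has_sum u U ->
  has_sum (fun y => if P && (y.1 == a) then c * u y.2 else 0) (if P then c * U else 0).
Proof.
case: P => /= [/(_ isT) c0 [u0 uU]|_ _]; last by split=> //; rewrite esum1.
have F0 (y : T1 * T2) : 0 <= if y.1 == a then c * u y.2 else 0.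
  by case: ifP; rewrite // mulr_ge0.
split=> //; rewrite esum_pair => [|y]; last by rewrite lee_fin.
transitivity (\esum_(x in [set: T1]) if x == a then \tsum_z (c * u z) else 0%E : \bar R).
  by apply: eq_esum => x _ /=; case: eqP => // _; rewrite esum1.
rewrite (esum_supp1 (f := fun=> \tsum_z (c * u z)%R)) ?tsumZl ?uU//.
by rewrite lee_fin mulr_ge0// -lee_fin -uU tsum_ge0.
Qed.

Lemma has_sum_diag (T : choiceType) (k : T) (u : T -> R) :
  0 <= u k -> has_sum (fun z => u z * (z == k)%:R) (u k).
Proof.
move=> uk; split=> [z|]; first by case: eqP => [->|]; rewrite ?mulr1 ?mulr0.
rewrite -(esum_supp1 (f := fun z => (u z)%:E))//.
by apply: eq_esum => z _; case: eqP => _; rewrite ?mulr1 ?mulr0.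
Qed.

Lemma nondecreasing_bounded_cvg (u : nat -> R) (M : R) :
  (forall n, u n <= u n.+1) -> (forall n, u n <= M) ->
  exists l, [/\ u @ \oo --> l, forall n, u n <= l & l <= M].
Proof.
move=> ui uM.
have ndu : nondecreasing_seq u by apply/nondecreasing_seqP.
have cu : cvgn u.
  by apply: nondecreasing_is_cvgn => //; exists M => _ [n _ <-].
exists (limn u); split => // [n|]; first exact: nondecreasing_cvgn_le.
by apply: limr_le => //; exact: nearW.
Qed.

End esum_extra.

(** * Subinvariant measures of irreducible chains *)

Section chains.
Context {R : realType} {S : choiceType} (b : S -> S -> R) (q : S -> R).
Hypothesis b_ge0 : forall x y, 0 <= b x y.
Hypothesis b_sum : forall x, (\tsum_y b x y = (q x)%:E)%E.

Lemma rate_le x y : b x y <= q x.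
Proof. by rewrite -lee_fin -b_sum; exact: (esum_ge_term (fun y => (b x y)%:E)). Qed.

Lemma total_rate_ge0 x : 0 <= q x.
Proof. exact: le_trans (rate_le x x). Qed.

(** Self-loops [b x x] may be positive and are counted in [q x]. Here and in [subinvariant] they
    contribute the same term to both sides. *)
Definition reuter := forall f : S -> R, (forall x, 0 <= f x) ->
  (exists M, forall x, f x <= M) ->
  (forall x, \tsum_y (b x y * f y) = ((1 + q x) * f x)%:E)%E ->
  forall x, f x = 0.

Definition subinvariant (w : S -> R) := (forall x, 0 <= w x) /\
  forall x, (\tsum_y (w y * b y x) <= (w x * q x)%:E)%E.

(* Probability that an exponential clock of rate 1 rings before the [n]-th jump
   of the chain started at [x]; its limit is 1 iff the chain does not explode. *)
Fixpoint survival n x : R := if n is m.+1 then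
  (1 + fine (\tsum_y (b x y * survival m y)%R)%E) / (1 + q x) else 0.

(** Guarantees that [fine] in [survival] is applied to a finite sum. *)
Lemma rate_bounded (h : S -> R) x : (forall y, 0 <= h y <= 1) ->
  exists2 g : R, (\tsum_y (b x y * h y) = g%:E)%E & 0 <= g <= q x.
Proof.
move=> h01.
have bh0 y : 0 <= b x y * h y by rewrite mulr_ge0//; case/andP: (h01 y).
have bhq : (\tsum_y (b x y * h y) <= (q x)%:E)%E.
  rewrite -b_sum; apply: le_tsum => y; rewrite ler_piMr//.
  by case/andP: (h01 y).
have [g hg] := tsum_bounded bh0 bhq.
by exists g => //; rewrite -!lee_fin -hg tsum_ge0.
Qed.

Lemma survival_bounds n x : 0 <= survival n x <= 1.
Proof.
elim: n x => [|n IH] x; first by rewrite /= lexx ler01.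
rewrite /=; have [g -> /andP[g0 gq] /=] := rate_bounded x IH.
have q0 : 0 < 1 + q x by rewrite ltr_wpDr// total_rate_ge0.
by rewrite ler_pdivrMr// mul1r lerD2l gq divr_ge0// ?ltW// ltr_wpDr.
Qed.

Lemma survivalS n x :
  (\tsum_y (b x y * survival n y) = ((1 + q x) * survival n.+1 x - 1)%:E)%E.
Proof.
have [g hg _] := rate_bounded x (survival_bounds n).
have q0 : 1 + q x != 0 by rewrite gt_eqF// ltr_wpDr// total_rate_ge0.
by rewrite /= hg /=; congr EFin; field.
Qed.

Lemma survival_le n x : survival n x <= survival n.+1 x.
Proof.
elim: n x => [|n IH] x; first by case/andP: (survival_bounds 1 x).
have q0 : 0 < 1 + q x by rewrite ltr_wpDr// total_rate_ge0.
rewrite -(ler_pM2l q0) -(lerD2r (-1)) -lee_fin -!survivalS.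
by apply: le_tsum => y; rewrite ler_wpM2l.
Qed.

Lemma survival_ub n x : survival n x <= 1.
Proof. by case/andP: (survival_bounds n x). Qed.

Hypothesis b_reuter : reuter.

(** The pointwise limit [l] satisfies the limiting recursion, so [1 - l] is a bounded nonnegative
    solution of Reuter's equation and vanishes. *)
Lemma survival_cvg x : survival ^~ x @ \oo --> (1 : R).
Proof.
have /choice[l hl] : forall x, exists l, [/\ (fun n => survival n x) @ \oo --> l,
    forall n, survival n x <= l & l <= 1].
  move=> y; apply: nondecreasing_bounded_cvg => n; first exact: survival_le.
  exact: survival_ub.
have l01 y : 0 <= l y <= 1.
  by have [_ /(_ 0%N) + ->] := hl y => ->.
have f0 y : 1 - l y = 0.
  apply: (b_reuter (f := fun y => 1 - l y)) => [z||z].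
  - by rewrite subr_ge0; have [] := hl z.
  - by exists 1 => z; rewrite lerBlDr lerDl; case/andP: (l01 z).
  have [g hg _] := rate_bounded z l01.
  have q0 : 0 < 1 + q z by rewrite ltr_wpDr// total_rate_ge0.
  have [cl hlu _] := hl z.
  (* The recursion passes to the limit as two inequalities: this one by the Fatou bound, the next
     one by monotonicity in [n]. *)
  have gle : g <= (1 + q z) * l z - 1.
    rewrite -lee_fin -hg; apply: (@tsum_lim_le _ _ (fun n y => b z y * survival n y)).
      by move=> t; apply: cvgM; [exact: cvg_cst|have [] := hl t].
    by move=> n; rewrite survivalS lee_fin lerD2r ler_pM2l.
  have gge : l z <= (1 + g) / (1 + q z).
    rewrite -(cvg_lim _ cl)//; apply: limr_le.
      by apply/cvg_ex; exists (l z).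
    apply: nearW => n; apply: le_trans (survival_le n z) _.
    rewrite ler_pdivlMr// mulrC -lerBlDl -lee_fin -survivalS -hg.
    by apply: le_tsum => u; rewrite ler_wpM2l//; have [] := hl u.
  move: gge; rewrite ler_pdivlMr// => gge.
  have : (\tsum_y (b z y * (1 - l y) + b z y * l y)%R = (q z)%:E)%E.
    by rewrite -b_sum; apply: eq_esum => u _; rewrite -mulrDr subrK mulr1.
  rewrite tsumD ?hg => [|u|u]; first last.
  - by rewrite mulr_ge0//; case/andP: (l01 u).
  - by rewrite mulr_ge0// subr_ge0; case/andP: (l01 u).
  have [g' -> _] : exists2 g' : R, (\tsum_y (b z y * (1 - l y)) = g'%:E)%E & 0 <= g' <= q z.
    by apply: rate_bounded => u; rewrite subr_ge0 lerBlDr lerDl andbC.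
  by rewrite -EFinD => -[E]; congr EFin; lra.
have [cl _ _] := hl x.
by rewrite (_ : 1 = l x)//; apply/eqP; rewrite -subr_eq0 f0.
Qed.

(** Let [d] be the defect of invariance. Testing [w] against the survival probabilities bounds the
    sum of [w + d], in the limit, by the total mass [W] of [w]; hence [d] is 0. *)
Lemma finite_subinvariant_invariant (w : S -> R) (W : R) :
  subinvariant w -> (\tsum_x w x = W%:E)%E ->
  forall x, (\tsum_y (w y * b y x) = (w x * q x)%:E)%E.
Proof.
move=> [w0 wsub] wW.
have wb0 x y : 0 <= w y * b y x by rewrite mulr_ge0.
have /choice[inn hinn] : forall x, exists v : R, (\tsum_y (w y * b y x) = v%:E)%E.
  by move=> x; exact: tsum_bounded (wb0 x) (wsub x).
pose d x := w x * q x - inn x.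
have d0 x : 0 <= d x by rewrite subr_ge0 -lee_fin -hinn.
have inn0 x : 0 <= inn x by rewrite -lee_fin -hinn tsum_ge0.
have h0 n x : 0 <= survival n x by case/andP: (survival_bounds n x).
have q0 := total_rate_ge0.
pose g n x := (1 + q x) * survival n.+1 x - 1.
have g0 n x : 0 <= g n x.
  by rewrite -lee_fin -survivalS tsum_ge0// => y; rewrite mulr_ge0.
have ws0 n x : 0 <= w x * survival n x by rewrite mulr_ge0.
have wqs0 n x : 0 <= w x * q x * survival n x by rewrite mulr_ge0// mulr_ge0.
have wg0 n x : 0 <= w x * g n x by rewrite mulr_ge0.
have wg n : (\tsum_x (w x * g n x) = \tsum_y (inn y * survival n y))%E.
  apply: (@tsum_exchange _ _ _ (fun x y => w x * (b x y * survival n y))).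
  - by move=> i j; rewrite !mulr_ge0.
  - by move=> i; rewrite tsumZl ?survivalS// => j; rewrite mulr_ge0.
  - move=> j; rewrite (eq_esum (b := fun i => (survival n j * (w i * b i j))%:E)).
      by rewrite tsumZl// hinn -EFinM mulrC.
    by move=> i _; congr EFin; ring.
(* The sum of [w q] itself may be infinite. Finiteness of its [survival n] weighted version is
   carried along the induction, so that this quantity can be subtracted. *)
have step n A : (\tsum_x (w x * q x * survival n x) = A%:E)%E ->
    (exists A', (\tsum_x (w x * q x * survival n.+1 x) = A'%:E)%E) /\
    (\tsum_x (w x * survival n x + d x * survival n x)%R <= W%:E)%E.
  move=> hA.
  have E1 : (\tsum_x (inn x * survival n x) + \tsum_x (d x * survival n x) = A%:E)%E.
    rewrite -tsumD => [|x|x]; rewrite ?mulr_ge0// -hA.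
    by apply: eq_esum => x _; congr EFin; rewrite /d; ring.
  have [B hB] : exists B : R, (\tsum_x (inn x * survival n x) = B%:E)%E.
    apply: (@tsum_bounded _ _ _ A) => [x|]; first by rewrite mulr_ge0.
    by rewrite -E1 leeDl// tsum_ge0// => x; rewrite mulr_ge0.
  have [D hD] : exists D : R, (\tsum_x (d x * survival n x) = D%:E)%E.
    apply: (@tsum_bounded _ _ _ A) => [x|]; first by rewrite mulr_ge0.
    by rewrite -E1 leeDr// tsum_ge0// => x; rewrite mulr_ge0.
  move: E1; rewrite hB hD -EFinD => -[E1].
  (* The recursion of [survival] summed against [w], with the order of summation exchanged in the
     jump term. *)
  have E2 : (\tsum_x (w x * survival n.+1 x) + \tsum_x (w x * q x * survival n.+1 x)
      = (W + B)%:E)%E.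
    rewrite EFinD -wW -hB -wg -tsumD; [|by []|by []].
    rewrite -tsumD; [|by []|by []].
    by apply: eq_esum => x _; congr EFin; rewrite /g; ring.
  have [C hC] : exists C : R, (\tsum_x (w x * survival n.+1 x) = C%:E)%E.
    apply: (@tsum_bounded _ _ _ (W + B)) => [x|]; first by [].
    by rewrite -E2 leeDl// tsum_ge0.
  have [A' hA'] : exists A' : R, (\tsum_x (w x * q x * survival n.+1 x) = A'%:E)%E.
    apply: (@tsum_bounded _ _ _ (W + B)) => [x|]; first by [].
    by rewrite -E2 leeDr// tsum_ge0.
  have AA' : A <= A'.
    by rewrite -lee_fin -hA -hA'; apply: le_tsum => x; apply: ler_wpM2l; [exact: mulr_ge0|exact: survival_le].
  split; first by exists A'.
  have le1 x : w x * survival n x + d x * survival n x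
      <= w x * survival n.+1 x + d x * survival n x.
    by rewrite lerD2r ler_wpM2l// survival_le.
  apply: le_trans (le_tsum le1) _.
  rewrite tsumD; [|by []|by move=> x; apply: mulr_ge0].
  rewrite hC hD -EFinD lee_fin.
  by move: E2; rewrite hC hA' -EFinD => -[E2]; lra.
have fin n : exists A, (\tsum_x (w x * q x * survival n x) = A%:E)%E.
  elim: n => [|n [A /step[]//]].
  by exists 0; rewrite esum1// => x _; rewrite mulr0.
have wdW : (\tsum_x (w x + d x)%R <= W%:E)%E.
  apply: (@tsum_lim_le _ _ (fun n x => w x * survival n x + d x * survival n x)).
    move=> x; rewrite -[X in _ --> X + _]mulr1 -[X in _ --> _ + X]mulr1.
    by apply: cvgD; apply: cvgM; (exact: cvg_cst || exact: survival_cvg).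
  by move=> n; have [A /step[]] := fin n.
move=> x; rewrite hinn; congr EFin; apply/eqP; rewrite eq_sym -subr_eq0.
have : w x = w x + d x.
  by apply: tsum_eq_term w0 _ wW wdW x => y; rewrite lerDl.
by move=> /eqP; rewrite addrC -subr_eq subrr eq_sym.
Qed.

Hypothesis b_irr : forall x y, clos_refl_trans S (fun a c => 0 < b a c) x y.

Lemma subinvariant_step (w : S -> R) x y : subinvariant w ->
  w x * b x y <= w y * q y.
Proof.
move=> [_ /(_ y)]; rewrite -lee_fin; apply: le_trans.
exact: (esum_ge_term (fun x => (w x * b x y)%:E)).
Qed.

(** Positivity propagates along edges, because the outflow of a state dominates the flow along each
    edge into it. *)
Lemma subinvariant_gt0 (w : S -> R) x : subinvariant w -> 0 < w x -> forall y, 0 < w y.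
Proof.
move=> ws + y; elim: (b_irr x y) => // {x y} [x y bxy wx|]; last by move=> x y z _ + _; auto.
have := lt_le_trans (mulr_gt0 wx bxy) (subinvariant_step x y ws).
by rewrite lt0r mulf_eq0 negb_or lt0r ws.1 andbT => /andP[/andP[->]].
Qed.

Lemma distribution_gt0 (p : S -> R) :
  subinvariant p -> (\tsum_x p x = 1)%E -> forall x, 0 < p x.
Proof.
move=> ps p1; have [[x px]|np] := pselect (exists x, 0 < p x).
  exact: subinvariant_gt0 ps px.
move: p1; rewrite esum1 => [/eqP|x _]; first by rewrite eq_sym onee_eq0.
by congr EFin; apply/eqP; rewrite eq_le ps.1 andbT leNgt; apply/negP => px; apply: np; exists x.
Qed.

(** For an edge from [y] to [x] and [c = v x / p x], the measure [min v (c p)] is finite and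
    subinvariant, hence invariant, and agrees with [c p] at [x]. Equal inflows at [x] with termwise
    domination force agreement at [y], so [v / p] cannot increase along edges. By irreducibility it
    is constant. *)
Lemma subinvariant_proportional (p v : S -> R) :
  (forall x, 0 <= p x) -> (\tsum_x p x = 1)%E ->
  (forall x, (\tsum_y (p y * b y x) = (p x * q x)%:E)%E) ->
  subinvariant v -> exists2 c, 0 <= c & forall x, v x = c * p x.
Proof.
move=> p0 p1 pinv vs.
have ps : subinvariant p by split => // x; rewrite pinv.
have pgt0 := distribution_gt0 ps p1.
have v0 := vs.1.
have edge x y : 0 < b y x -> v x / p x <= v y / p y.
  move=> byx; pose c := v x / p x.
  have c0 : 0 <= c by rewrite divr_ge0.
  pose w z := Num.min (v z) (c * p z).
  have w0 z : 0 <= w z by rewrite le_min v0 mulr_ge0.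
  have wcp z : w z <= c * p z by rewrite ge_min lexx orbT.
  have cp1 : (\tsum_z (c * p z) = c%:E)%E by rewrite tsumZl// p1 mule1.
  have [W wW] : exists W : R, (\tsum_z w z = W%:E)%E.
    by apply: (@tsum_bounded _ _ _ c) => //; rewrite -cp1; exact: le_tsum.
  have cpinv z : (\tsum_y (c * p y * b y z) = (c * p z * q z)%:E)%E.
    under eq_esum do rewrite -mulrA.
    by rewrite tsumZl// ?pinv -?EFinM ?mulrA// => t; rewrite mulr_ge0.
  (* At each state the minimum is one of the two measures, and the inflow of [w] is at most that of
     either. *)
  have ws : subinvariant w.
    split=> // z; have [vc|/ltW cv] := leP (v z) (c * p z).
      rewrite {2}/w min_l//; apply: le_trans (vs.2 z).
      by apply: le_tsum => t; rewrite ler_wpM2r// ge_min lexx.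
    rewrite {2}/w min_r// -cpinv.
    by apply: le_tsum => t; rewrite ler_wpM2r.
  have winv := finite_subinvariant_invariant ws wW.
  have wx : w x = c * p x by rewrite /w /c divfK ?gt_eqF// minxx.
  have := tsum_eq_term (f := fun z => w z * b z x) (g := fun z => c * p z * b z x).
  move=> /(_ (c * p x * q x)) /(_ _ _ _ _ y) E.
  have /mulIf : w y * b y x = c * p y * b y x.
    apply: E => [z|z||]; [by rewrite mulr_ge0|by rewrite ler_wpM2r| |by rewrite cpinv].
    by rewrite winv wx.
  rewrite gt_eqF// => /(_ isT) wy.
  by rewrite -/c ler_pdivlMr// -wy ge_min lexx.
have mono x y : v y / p y <= v x / p x.
  by elim: (b_irr x y) => // {x y} [x y /edge//|x y z _ + _ h]; apply: le_trans.
have [[z _]|noS] := pselect (exists x : S, True); last first.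
  by exists 0 => // x; exfalso; apply: noS; exists x.
exists (v z / p z) => [|x]; first by rewrite divr_ge0.
by rewrite (@le_anti _ _ (v z / p z) (v x / p x)) ?mono// divfK// gt_eqF.
Qed.

(* Green measure from [o] of the chain killed at rate 1 in [o]: the killed mass
   is at most 1, which bounds the measure at [o]. *)
Fixpoint green (o : S) n x : R := if n is m.+1 then
  ((x == o)%:R + fine (\tsum_y (green o m y * b y x)%R)%E) / (q x + (x == o)%:R)
  else 0.

(** A path from [x] to [o] has a first edge. This keeps the denominator in [green] positive. *)
Lemma irreducible_total_rate_gt0 o x : x != o -> 0 < q x.
Proof.
move=> + ; have /clos_rt_rt1n_iff := b_irr x o.
case=> [|y z bxy _ _]; first by rewrite eqxx.
exact: lt_le_trans bxy (rate_le _ _).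
Qed.

(** The iterates [green o n] increase in [n] and stay bounded at each state; their limit is
    subinvariant by the Fatou bound. *)
Lemma exists_subinvariant o : exists2 w, subinvariant w & 0 < w o.
Proof.
have q0 := total_rate_ge0.
have d0 x : 0 < q x + (x == o)%:R.
  have [->|xo] := eqVneq x o; first by rewrite ltr_wpDl.
  by rewrite addr0 (irreducible_total_rate_gt0 xo).
pose g := green o.
pose flow n x := g n.+1 x * (q x + (x == o)%:R) - (x == o)%:R.
have flowE n : (forall x, 0 <= g n x) -> (exists A, (\tsum_x (g n x * q x) = A%:E)%E) ->
    forall x, (\tsum_y (g n y * b y x) = (flow n x)%:E)%E.
  move=> gn0 [A hA] x.
  have [v hv] : exists v : R, (\tsum_y (g n y * b y x) = v%:E)%E.
    apply: (@tsum_bounded _ _ _ A) => [y|]; first by rewrite mulr_ge0.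
    by rewrite -hA; apply: le_tsum => y; rewrite ler_wpM2l ?rate_le.
  by rewrite /flow {2}/g /= -/g hv /= divfK ?gt_eqF//; congr EFin; ring.
(* Finite total outflow makes every inflow finite, so that [fine] in [green] loses nothing. *)
have inv n : (forall x, 0 <= g n x) /\ exists A, (\tsum_x (g n x * q x) = A%:E)%E.
  elim: n => [|n [gn0 gnA]].
    by split=> //; exists 0; rewrite esum1// => x _; rewrite mul0r.
  have gS x : 0 <= g n.+1 x.
    apply: divr_ge0; last exact: ltW.
    rewrite addr_ge0// fine_ge0// tsum_ge0// => y.
    by rewrite mulr_ge0// gn0.
  split=> //; have [A hA] := gnA.
  have gb0 y x : 0 <= g n y * b y x by rewrite mulr_ge0.
  have fl0 x : 0 <= flow n x by rewrite -lee_fin -flowE// tsum_ge0.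
  have flA : (\tsum_x flow n x = A%:E)%E.
    rewrite -hA; symmetry; apply: (tsum_exchange (a := fun y x => g n y * b y x)) => // y.
      by rewrite tsumZl// b_sum.
    exact: flowE.
  apply: (@tsum_bounded _ _ _ (A + 1)) => [x|]; first by rewrite mulr_ge0.
  have -> : ((A + 1)%:E = \tsum_x (flow n x + (if x == o then 1 else 0))%R)%E.
    rewrite tsumD// => [|x]; last by case: ifP.
    rewrite flA EFinD; congr (_ + _)%E.
    by rewrite -[LHS](esum_supp1 (f := cst 1%E) (x := o))//; apply: eq_esum => x _; case: ifP.
  by apply: le_tsum => x; rewrite /flow; case: eqP => _; rewrite subrK// ler_wpM2l// lerDl.
have g0 n x : 0 <= g n x by have [] := inv n.
have {}flowE n x : (\tsum_y (g n y * b y x) = (flow n x)%:E)%E.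
  by have [gn0 gnA] := inv n; exact: flowE.
have gmono n x : g n x <= g n.+1 x.
  elim: n x => [|n IH] x; first exact: g0.
  rewrite -(ler_pM2r (d0 x)) -(lerD2r (- (x == o)%:R)) -lee_fin -!flowE.
  by apply: le_tsum => y; rewrite ler_wpM2r.
(* Mass balance: the total outflow of [g n.+1] plus the killed mass [g n.+1 o] equals the total
   outflow of [g n] plus 1, and the outflow does not decrease with [n]. *)
have go1 n : g n.+1 o <= 1.
  have [gn0 [A hA]] := inv n; have [_ [B hB]] := inv n.+1.
  have AB : A <= B.
    by rewrite -lee_fin -hA -hB; apply: le_tsum => x; rewrite ler_wpM2r.
  have fl0 x : 0 <= flow n x.
    by rewrite -lee_fin -flowE// tsum_ge0// => y; rewrite mulr_ge0.
  have flA : (\tsum_x flow n x = A%:E)%E.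
    rewrite -hA; symmetry; apply: (tsum_exchange (a := fun y x => g n y * b y x)) => //.
    - by move=> y x; rewrite mulr_ge0.
    - by move=> y; rewrite tsumZl// b_sum.
  have ind (c : R) : 0 <= c -> (\tsum_x (if x == o then c else 0) = c%:E)%E.
    move=> c0; rewrite -[RHS](esum_supp1 (f := cst c%:E) (x := o))//.
    by apply: eq_esum => x _; case: ifP.
  have : (\tsum_x (g n.+1 x * q x + (if x == o then g n.+1 o else 0))%R
      = \tsum_x (flow n x + (if x == o then 1 else 0))%R)%E.
    apply: eq_esum => x _; congr EFin; rewrite /flow.
    by case: eqP => [->|_]; rewrite /= ?mulr1n ?mulr0n; ring.
  have if0 (c : R) x : 0 <= c -> 0 <= (if x == o then c else 0) by case: ifP.
  have gq0 x : 0 <= g n.+1 x * q x by rewrite mulr_ge0.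
  rewrite (tsumD gq0 (fun x => if0 _ x (g0 _ _))) (tsumD fl0 (fun x => if0 _ x ler01)).
  by rewrite hB flA !ind// -!EFinD => -[E]; lra.
(* The bound at [o] is carried backwards along a path to [o]: a bound at [y] limits the inflow at
   [y], hence [g n x] for each edge from [x] to [y]. *)
have gub x : exists M, forall n, g n x <= M.
  have : exists M, forall n, g n o <= M.
    by exists 1 => n; apply: le_trans (gmono n _) (go1 n).
  elim: (b_irr x o) => // {x} [x y bxy [M hM]|x y z _ + _ h /h]; last exact.
  exists (M * (q y + (y == o)%:R) / b x y) => n.
  rewrite ler_pdivlMr//.
  apply: (@le_trans _ _ (flow n y)).
    rewrite -lee_fin -flowE.
    exact: (esum_ge_term (fun x => (g n x * b x y)%:E)).
  by rewrite lerBlDr ler_wpDr// ler_pM2r.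
have /choice[w hw] : forall x, exists l,
    [/\ (fun n => g n x) @ \oo --> l & forall n, g n x <= l].
  move=> x; have [M hM] := gub x.
  by have [l []] := nondecreasing_bounded_cvg (gmono ^~ x) hM; exists l.
have w0 x : 0 <= w x by have [_ /(_ 0%N)] := hw x.
have wo1 : w o <= 1.
  have [cw _] := hw o; rewrite -(cvg_lim _ cw)//; apply: limr_le.
    by apply/cvg_ex; exists (w o).
  by apply: nearW => n; apply: le_trans (gmono n _) (go1 n).
exists w; last first.
  have [_ /(_ 1%N)] := hw o; apply: lt_le_trans.
  rewrite /g /= esum1 => [|y _]; last by rewrite mul0r.
  by rewrite eqxx addr0 divr_gt0// ltr_wpDl.
split=> // x.
apply: (@tsum_lim_le _ _ (fun n y => g n y * b y x)) => [y|n].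
  by apply: cvgM; [have [] := hw y|exact: cvg_cst].
rewrite flowE lee_fin lerBlDr.
have [_ /(_ n.+1) gw] := hw x.
apply: le_trans (ler_wpM2r (ltW (d0 x)) gw) _; rewrite mulrDr lerD2l.
by case: eqP => [->|_]; rewrite ?mulr1 ?mulr0.
Qed.

End chains.

(** * Adding and removing customers in occupation vectors *)

Section vectors.
Variable J : nat.
Implicit Types (n m : {ffun 'I_J -> nat}) (i j : 'I_J).

Lemma addv_id n i : addv n i i = (n i).+1.
Proof. by rewrite ffunE eqxx addn1. Qed.

Lemma subvK n i : (0 < n i)%N -> addv (subv n i) i = n.
Proof.
move=> ni; apply/ffunP => l; rewrite !ffunE; have [->|_] := eqVneq l i.
  by rewrite subnK.
by rewrite subn0 addn0.
Qed.

Lemma addvK n i : subv (addv n i) i = n.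
Proof. by apply/ffunP => l; rewrite !ffunE addnK. Qed.

(** This and the next two lemmas solve a transition for its source, as inflow sums require. The
    guard compensates for truncated subtraction. *)
Lemma eq_addv n m i : (n == addv m i) = (0 < n i)%N && (m == subv n i).
Proof.
apply/eqP/andP => [->|[ni /eqP ->]]; last by rewrite subvK.
by rewrite addv_id addvK.
Qed.

Lemma eq_subv n m j : (0 < m j)%N && (n == subv m j) = (m == addv n j).
Proof.
by rewrite eq_addv.
Qed.

Lemma eq_transfer n m i j : (0 < m j)%N && (n == addv (subv m j) i)
  = (0 < n i)%N && (m == addv (subv n i) j).
Proof. by rewrite !eq_addv andbCA [subv n i == _]eq_sym. Qed.

Lemma addv_neq n i : (n == addv n i) = false.
Proof. by apply/eqP => /ffunP/(_ i); rewrite addv_id => /n_Sn. Qed.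

Lemma subv_neq n j : (0 < n j)%N -> (n == subv n j) = false.
Proof. by move=> nj; apply/eqP => /ffunP/(_ j); rewrite ffunE eqxx; move: (n j) nj => [//|m _]; rewrite subn1 => /esym/n_Sn. Qed.

Lemma transfer_neq n i j : i != j -> (n == addv (subv n j) i) = false.
Proof.
move=> /negPf ij; apply/eqP => /ffunP/(_ i); by rewrite addv_id ffunE ij subn0 => /n_Sn.
Qed.

End vectors.

(** * Algebra of the reflection parameters *)

Section reflection.
Context {R : realType} {J : nat} (g : 'I_J -> R).
Hypothesis g0 : forall j, 0 <= g j.

Lemma alpha_ge0 i : 0 <= alpha g i.
Proof.
case: i => [j|] /=; last exact: ler01.
by case: (leP (supnorm g)) => // h; rewrite divr_ge0// ltW// (lt_trans ltr01 h).
Qed.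

Lemma beta_alpha j : beta g * alpha g (Some j) = g j.
Proof.
rewrite /beta /=; case: (leP (supnorm g)) => [_|h]; first by rewrite mul1r.
by rewrite mulrC divfK// gt_eqF// (lt_trans ltr01).
Qed.

(** Both sides equal [beta g] times the two acceptance probabilities. This symmetry lets
    reversibility survive the reflection. *)
Lemma alphaC i j : g i * alpha g (Some j) = g j * alpha g (Some i).
Proof. by rewrite -!beta_alpha; ring. Qed.

Lemma rrefl_neq (a : option 'I_J -> R) r i j : i != j -> rrefl a r i j = r i j * a j.
Proof. by rewrite /rrefl => /negPf ->. Qed.

End reflection.

(** * Rates of Z and of the reduced environment *)

Section Jackson.
Context {R : realType} {J : nat} (lam : R) (mu : 'I_J -> nat -> R)
  (r : option 'I_J -> option 'I_J -> R) (eta : option 'I_J -> R)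
  {K : countType} (nu : K -> K -> R) (Rm : 'I_J -> K -> K -> R)
  (gamma : K -> 'I_J -> R).
Hypothesis lam_gt0 : 0 < lam.
Hypothesis mu_gt0 : forall j n, (0 < n)%N -> 0 < mu j n.
Hypothesis r_ge0 : forall i j, 0 <= r i j.
Hypothesis r_irr : forall i j, clos_refl_trans (option 'I_J) (fun a b => 0 < r a b) i j.
Hypothesis eta_None : eta None = lam.
Hypothesis eta_rev : forall i j, eta i * r i j = eta j * r j i.
Hypothesis nu_ge0 : forall k m, k != m -> 0 <= nu k m.
Hypothesis nu_sum : forall k, (\esum_(m in [set m | m != k]) (nu k m)%:E = (- nu k k)%:E)%E.
Hypothesis Rm_ge0 : forall j k m, 0 <= Rm j k m.
Hypothesis Rm_sum : forall j k, (\esum_(m in [set: K]) (Rm j k m)%:E = 1)%E.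
Hypothesis gamma_ge0 : forall k j, 0 <= gamma k j.

(** Positivity spreads from node 0 along routing edges, by reversibility. *)
Lemma eta_gt0 j : 0 < eta j.
Proof.
have : 0 < eta None by rewrite eta_None.
elim: (r_irr None j) => [{j} i j rij ei||a b c _ h1 _ h2 /h1/h2//]; last by [].
have : 0 < eta j * r j i by rewrite -eta_rev mulr_gt0.
move=> h; have : 0 < r j i.
  by rewrite lt0r r_ge0 andbT; apply: contraTneq h => ->; rewrite mulr0 ltxx.
by move=> rji; move: h; rewrite pmulr_lgt0.
Qed.

(** No reflection factor appears, since node 0 has acceptance probability 1. *)
Definition exit_rate k j := gamma k j * r (Some j) None.
Definition transfer_rate k j i := gamma k j * r (Some j) (Some i) * alpha (gamma k) (Some i).
Definition nu_off k m := if m == k then 0 else nu k m.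

(* Unlike [Qred], [red_rate] keeps the self-loops [R_j k k]; [red_total k] is
   its row sum. *)
Definition red_rate k m := nu_off k m + \sum_j eta (Some j) * exit_rate k j * Rm j k m.
Definition red_total k := - nu k k + \sum_j eta (Some j) * exit_rate k j.

Lemma eta_ge0 j : 0 <= eta j. Proof. exact/ltW/eta_gt0. Qed.

Lemma mu_ge0 j n : (0 < n)%N -> 0 <= mu j n. Proof. by move=> /(mu_gt0 j)/ltW. Qed.

Lemma exit_rate_ge0 k j : 0 <= exit_rate k j.
Proof. by rewrite mulr_ge0. Qed.

Lemma transfer_rate_ge0 k j i : 0 <= transfer_rate k j i.
Proof. by rewrite !mulr_ge0// alpha_ge0. Qed.

Lemma eta_transfer_rateC k i j :
  eta (Some j) * transfer_rate k j i = eta (Some i) * transfer_rate k i j.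
Proof.
rewrite /transfer_rate.
transitivity ((eta (Some j) * r (Some j) (Some i)) * (gamma k j * alpha (gamma k) (Some i))).
  by ring.
by rewrite eta_rev alphaC; ring.
Qed.

Lemma nu_off_ge0 k m : 0 <= nu_off k m.
Proof. by rewrite /nu_off; case: eqVneq => // mk; rewrite nu_ge0// eq_sym. Qed.

Lemma has_sum_nu_off k : has_sum (nu_off k) (- nu k k).
Proof.
split=> [m|]; first exact: nu_off_ge0.
rewrite -nu_sum esum_offdiag; apply: eq_esum => m _.
by rewrite /nu_off; case: eqP.
Qed.

Lemma eta_exit_rate_ge0 k j : 0 <= eta (Some j) * exit_rate k j.
Proof. by rewrite mulr_ge0 ?eta_ge0 ?exit_rate_ge0. Qed.

Lemma has_sum_red_rate k : has_sum (red_rate k) (red_total k).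
Proof.
apply: has_sumD; first exact: has_sum_nu_off.
apply: has_sum_sum => j; rewrite -[X in has_sum _ X]mulr1.
by apply: (has_sumZ (f := Rm j k)); [exact: eta_exit_rate_ge0|split].
Qed.

Lemma red_rate_ge0 k m : 0 <= red_rate k m.
Proof. by case: (has_sum_red_rate k). Qed.

Local Notation Zrate := (env_rate lam r mu nu Rm gamma).

(** Reversibility turns the arrival rate at [i] into [eta (Some i) * exit_rate k i]. The trivial
    guards and factors give every summand the shape required by [has_sum_slice]. *)
Lemma env_rateE x y : Zrate x y =
  \sum_i (if true && (y.1 == addv x.1 i)
          then 1 * (eta (Some i) * exit_rate x.2 i * (x.2 == y.2)%:R) else 0)
  + \sum_j \sum_i (if [&& i != j & (0 < x.1 j)%N] && (y.1 == addv (subv x.1 j) i)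
          then mu j (x.1 j) * (transfer_rate x.2 j i * (x.2 == y.2)%:R) else 0)
  + \sum_j (if (0 < x.1 j)%N && (y.1 == subv x.1 j)
          then mu j (x.1 j) * (exit_rate x.2 j * Rm j x.2 y.2) else 0)
  + (if true && (y.1 == x.1) then 1 * nu_off x.2 y.2 else 0).
Proof.
case: x y => [n k] [n' m]; rewrite /env_rate /=.
congr (_ + _ + _); last first.
- by rewrite /nu_off mul1r; case: eqP => //= _; case: eqP.
- apply: eq_bigr => j _; case: ifP => // _.
  by rewrite rrefl_neq//= mulr1 /exit_rate; ring.
have [_|_] := eqVneq m k; last first.
  rewrite !big1 ?addr0// => [j _|i _]; last by case: ifP; rewrite // !mulr0.
  by rewrite big1// => i _; case: ifP; rewrite // !mulr0.
congr (_ + _).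
  apply: eq_bigr => i _; case: ifP => // _; rewrite rrefl_neq// !mulr1n mulr1 mul1r.
  transitivity (gamma k i * (eta (Some i) * r (Some i) None)).
    by rewrite eta_rev eta_None -(beta_alpha (gamma k)); ring.
  by rewrite /exit_rate; ring.
apply: eq_bigr => j _; apply: eq_bigr => i _; rewrite -!andbA.
case: ifP => // /andP[ij _]; rewrite rrefl_neq; last by rewrite eq_sym.
by rewrite /transfer_rate mulr1n; ring.
Qed.

Lemma env_rate_diag x : Zrate x x = 0.
Proof.
rewrite env_rateE /nu_off eqxx mulr0 if_same addr0.
rewrite !big1 ?addr0// => [j _|j _|j _]; last by rewrite addv_neq.
- by case: ifP => // /andP[/subv_neq ->].
- by rewrite big1// => i _; case: ifP => // /andP[/andP[ij _]]; rewrite transfer_neq.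
Qed.

Definition service_rate (x : {ffun 'I_J -> nat} * K) : R :=
  \sum_j \sum_i (if (i != j) && (0 < x.1 j)%N then mu j (x.1 j) * transfer_rate x.2 j i else 0)
  + \sum_j (if (0 < x.1 j)%N then mu j (x.1 j) * exit_rate x.2 j else 0).

(** Arrivals, rewritten through [exit_rate], and environment jumps together have total rate
    [red_total]; services contribute the rest. *)
Lemma has_sum_env_rate x : has_sum (Zrate x) (service_rate x + red_total x.2).
Proof.
have pos j : (0 < x.1 j)%N -> 0 <= mu j (x.1 j) by exact: mu_ge0.
apply: (eq_has_sum (v :=
    \sum_i (if true then 1 * (eta (Some i) * exit_rate x.2 i) else 0)
    + \sum_j \sum_i (if (i != j) && (0 < x.1 j)%N
                     then mu j (x.1 j) * transfer_rate x.2 j i else 0)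
    + \sum_j (if (0 < x.1 j)%N then mu j (x.1 j) * (exit_rate x.2 j * 1) else 0)
    + (if true then 1 * - nu x.2 x.2 else 0)) (env_rateE x)); last first.
  apply: has_sumD; [apply: has_sumD; [apply: has_sumD|]|].
  - apply: has_sum_sum => i; apply: (has_sum_slice (P := true) _ (c := 1)
      (u := fun m => eta (Some i) * exit_rate x.2 i * (x.2 == m)%:R)) => //.
    under eq_fun do rewrite eq_sym.
    by apply: (has_sum_diag (u := fun=> eta (Some i) * exit_rate x.2 i)); exact: eta_exit_rate_ge0.
  - apply: has_sum_sum => j; apply: has_sum_sum => i.
    apply: (has_sum_slice _ (u := fun m => transfer_rate x.2 j i * (x.2 == m)%:R)) => [/andP[_ /pos]//|].
    under eq_fun do rewrite eq_sym.
    by apply: (has_sum_diag (u := fun=> transfer_rate x.2 j i)); exact: transfer_rate_ge0.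
  - apply: has_sum_sum => j.
    apply: (has_sum_slice _ (u := fun m => exit_rate x.2 j * Rm j x.2 m)); first exact: pos.
    by apply: (has_sumZ (f := Rm j x.2)); [exact: exit_rate_ge0|split].
  - by apply: (has_sum_slice (P := true) _ (c := 1)) => //; exact: has_sum_nu_off.
rewrite /service_rate /red_total mul1r.
under [X in _ = X + _ + _ + _]eq_bigr do rewrite mul1r.
under [X in _ = _ + X + _]eq_bigr do rewrite mulr1.
by ring.
Qed.

Lemma env_rate_ge0 x y : 0 <= Zrate x y.
Proof. by case: (has_sum_env_rate x). Qed.

(** * Inflow under a product measure *)

Section product_form.
Variables (X : {ffun 'I_J -> nat} -> R) (theta : K -> R).
Hypothesis X_ge0 : forall n, 0 <= X n.
Hypothesis X_addv : forall n j, X (addv n j) * mu j (n j).+1 = eta (Some j) * X n.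
Hypothesis theta_ge0 : forall k, 0 <= theta k.

Lemma X_subv (n : {ffun 'I_J -> nat}) i : (0 < n i)%N -> eta (Some i) * X (subv n i) = X n * mu i (n i).
Proof.
by move=> ni; rewrite -X_addv -[in RHS](subvK ni) addv_id.
Qed.

(** Arrivals into the state balance its departures, and transfers from [j] to [i] balance those from
    [i] to [j]; together they give the service term. Departures from [addv n j] and environment
    jumps combine into [X n * I]. *)
Lemma product_inflow (n : {ffun 'I_J -> nat}) k I : has_sum (fun m => theta m * red_rate m k) I ->
  has_sum (fun y => X y.1 * theta y.2 * Zrate y (n, k))
    (X n * (theta k * service_rate (n, k) + I)).
Proof.
move=> hI.
have rate0 m j : 0 <= eta (Some j) * exit_rate m j * Rm j m k.
  by rewrite mulr_ge0 ?eta_exit_rate_ge0.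
have nu_le m : theta m * nu_off m k <= theta m * red_rate m k.
  by rewrite ler_wpM2l// lerDl sumr_ge0.
have [|N hN] := has_sum_le _ nu_le hI; first by move=> m; rewrite mulr_ge0 ?nu_off_ge0.
(* [T j] is the flow into environment [k] caused by exits from [j]; its finiteness follows from that
   of [I] after division by [eta (Some j)]. *)
have /choice[T hT] : forall j, exists w,
    has_sum (fun m => theta m * exit_rate m j * Rm j m k) w.
  move=> j; have c0 : 0 <= (eta (Some j))^-1 by rewrite invr_ge0 eta_ge0.
  apply: (has_sum_le _ _ (has_sumZ c0 hI)) => m.
    by rewrite mulr_ge0// mulr_ge0 ?exit_rate_ge0.
  rewrite -(ler_pM2l (eta_gt0 (Some j))) mulVKf ?gt_eqF ?eta_gt0//.
  rewrite [leLHS](_ : _ = theta m * (eta (Some j) * exit_rate m j * Rm j m k)); last by ring.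
  rewrite ler_wpM2l// /red_rate (bigD1 j)//= addrCA lerDl.
  by rewrite addr_ge0 ?nu_off_ge0 ?sumr_ge0.
have NT : N + \sum_j eta (Some j) * T j = I.
  have : has_sum (fun m => theta m * red_rate m k) (N + \sum_j eta (Some j) * T j).
    have := has_sumD hN (has_sum_sum (fun j => has_sumZ (eta_ge0 (Some j)) (hT j))).
    apply: eq_has_sum => // m; rewrite mulrDr mulr_sumr; congr (_ + _).
    by apply: eq_bigr => j _; ring.
  by move=> [_]; rewrite hI.2 => -[->].
(* The inflow is now indexed by the source: a transfer from [j] to [i] that ends in [n] starts in
   [addv (subv n i) j]. *)
apply: (eq_has_sum (v :=
    \sum_i (if (0 < n i)%N
       then X (subv n i) * (theta k * (eta (Some i) * exit_rate k i)) else 0)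
    + \sum_j \sum_i (if (i != j) && (0 < n i)%N
       then X (addv (subv n i) j) * mu j (subv n i j).+1 * (theta k * transfer_rate k j i) else 0)
    + \sum_j (if true then X (addv n j) * mu j (n j).+1 * T j else 0)
    + (if true then X n * N else 0))
  (f := fun y => \sum_i (if (0 < n i)%N && (y.1 == subv n i)
          then X (subv n i) * (theta y.2 * (eta (Some i) * exit_rate y.2 i) * (y.2 == k)%:R)
          else 0)
  + \sum_j \sum_i (if [&& i != j & (0 < n i)%N] && (y.1 == addv (subv n i) j)
          then X (addv (subv n i) j) * mu j (subv n i j).+1
               * (theta y.2 * transfer_rate y.2 j i * (y.2 == k)%:R) else 0)
  + \sum_j (if true && (y.1 == addv n j)
          then X (addv n j) * mu j (n j).+1 * (theta y.2 * exit_rate y.2 j * Rm j y.2 k) else 0)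
  + (if true && (y.1 == n) then X n * (theta y.2 * nu_off y.2 k) else 0))).
- move=> y; rewrite env_rateE /= !mulrDr !mulr_sumr; congr (_ + _ + _ + _).
  + apply: eq_bigr => i _; rewrite eq_addv.
    by case: ifP => [/andP[_ /eqP ->]|_]; [ring|rewrite mulr0].
  + apply: eq_bigr => j _; rewrite mulr_sumr; apply: eq_bigr => i _.
    rewrite -andbA eq_transfer -andbA.
    by case: ifP => [/and3P[_ _ /eqP ->]|_]; [rewrite addv_id; ring|rewrite mulr0].
  + apply: eq_bigr => j _; rewrite eq_subv.
    by case: ifP => [/eqP ->|_]; [rewrite addv_id; ring|rewrite mulr0].
  + by rewrite eq_sym; case: ifP => [/eqP ->|_]; [ring|rewrite mulr0].
- have EA : \sum_i (if (0 < n i)%N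
        then X (subv n i) * (theta k * (eta (Some i) * exit_rate k i)) else 0)
      = X n * theta k * \sum_i (if (0 < n i)%N then mu i (n i) * exit_rate k i else 0).
    rewrite mulr_sumr; apply: eq_bigr => i _; case: ifP => [ni|_]; last by rewrite mulr0.
    transitivity (eta (Some i) * X (subv n i) * (theta k * exit_rate k i)); first by ring.
    by rewrite X_subv//; ring.
  have EB : \sum_j \sum_i (if (i != j) && (0 < n i)%N
        then X (addv (subv n i) j) * mu j (subv n i j).+1 * (theta k * transfer_rate k j i) else 0)
      = X n * theta k * \sum_j \sum_i
        (if (i != j) && (0 < n j)%N then mu j (n j) * transfer_rate k j i else 0).
    rewrite exchange_big mulr_sumr; apply: eq_bigr => i _.
    rewrite mulr_sumr; apply: eq_bigr => j _; rewrite eq_sym.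
    case: ifP => [/andP[_ ni]|_]; last by rewrite mulr0.
    rewrite X_addv.
    transitivity (X (subv n i) * theta k * (eta (Some j) * transfer_rate k j i)); first by ring.
    rewrite eta_transfer_rateC.
    transitivity (eta (Some i) * X (subv n i) * (theta k * transfer_rate k i j)); first by ring.
    by rewrite X_subv//; ring.
  have EC : \sum_j X (addv n j) * mu j (n j).+1 * T j = X n * \sum_j eta (Some j) * T j.
    by rewrite mulr_sumr; apply: eq_bigr => j _; rewrite X_addv; ring.
  by rewrite EA EB EC -NT /service_rate /=; ring.
apply: has_sumD; [apply: has_sumD; [apply: has_sumD|]|].
- apply: has_sum_sum => i; apply: (has_sum_slice _
    (u := fun m => theta m * (eta (Some i) * exit_rate m i) * (m == k)%:R)) => //.
  apply: (has_sum_diag (u := fun m => theta m * (eta (Some i) * exit_rate m i))).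
  by rewrite mulr_ge0 ?eta_exit_rate_ge0.
- apply: has_sum_sum => j; apply: has_sum_sum => i; apply: (has_sum_slice _
    (u := fun m => theta m * transfer_rate m j i * (m == k)%:R)) => [_|].
    by rewrite mulr_ge0 ?mu_ge0.
  apply: (has_sum_diag (u := fun m => theta m * transfer_rate m j i)).
  by rewrite mulr_ge0 ?transfer_rate_ge0.
- apply: has_sum_sum => j; apply: (has_sum_slice (P := true) _
    (u := fun m => theta m * exit_rate m j * Rm j m k)) => // _.
  by rewrite mulr_ge0 ?mu_ge0.
- exact: (has_sum_slice (P := true) _ (u := fun m => theta m * nu_off m k)).
Qed.

Lemma product_subinvariant : subinvariant red_rate red_total theta ->
  subinvariant Zrate (fun x => service_rate x + red_total x.2)
    (fun x => X x.1 * theta x.2).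
Proof.
move=> [_ ts]; split=> [x|[n k]]; first by rewrite mulr_ge0.
have f0 m : 0 <= theta m * red_rate m k by rewrite mulr_ge0 ?red_rate_ge0.
have [I hI] := tsum_bounded f0 (ts k).
have [_ ->] := product_inflow n (conj f0 hI).
rewrite lee_fin /= -mulrA ler_wpM2l// [leRHS]mulrDr lerD2l.
by rewrite -lee_fin -hI.
Qed.

End product_form.

(** [Qred] is [red_rate] minus the diagonal matrix of [red_total], so the two equations differ by
    the self-loop term [theta k * red_rate k k] on both sides. *)
Lemma left_null_balance (theta : K -> R) : (forall k, 0 <= theta k) ->
  left_null (Qred r eta nu Rm gamma) theta <->
  forall k, has_sum (fun m => theta m * red_rate m k) (theta k * red_total k).
Proof.
move=> t0.
have QE k m : Qred r eta nu Rm gamma k m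
    = red_rate k m - (k == m)%:R * red_total k.
  rewrite /Qred /red_rate /red_total /nu_off [m == k]eq_sym.
  have -> : \sum_j eta (Some j) * (gamma k j * rrefl (alpha (gamma k)) r (Some j) None)
        * (Rm j k m - (k == m)%:R)
      = \sum_j eta (Some j) * exit_rate k j * Rm j k m
        - (k == m)%:R * \sum_j eta (Some j) * exit_rate k j.
    rewrite mulr_sumr -sumrB; apply: eq_bigr => j _.
    by rewrite rrefl_neq//= mulr1 /exit_rate; ring.
  by case: eqP => [->|_] /=; rewrite ?mulr1n; ring.
have f0 m k : 0 <= theta m * red_rate m k by rewrite mulr_ge0 ?red_rate_ge0.
have offE k : \esum_(m in [set m | m != k]) (theta m * Qred r eta nu Rm gamma m k)%:E
    = \tsum_m (if m == k then 0 else theta m * red_rate m k).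
  rewrite esum_offdiag; apply: eq_esum => m _; rewrite QE.
  by case: eqP => //= _; rewrite mul0r subr0.
have off0 k m : 0 <= if m == k then 0 else theta m * red_rate m k by case: ifP.
have on k : has_sum (fun m => if m == k then theta m * red_rate m k else 0)
    (theta k * red_rate k k).
  apply: eq_has_sum (has_sum_diag (u := fun m => theta m * red_rate m k) (f0 k k)) => //.
  by move=> m; case: eqP => _; rewrite ?mulr1 ?mulr0.
have split_sum k v : has_sum (fun m => if m == k then 0 else theta m * red_rate m k) v ->
    has_sum (fun m => theta m * red_rate m k) (v + theta k * red_rate k k).
  move=> h; apply: eq_has_sum (has_sumD h (on k)) => // m.
  by case: ifP; rewrite ?addr0 ?add0r.
split=> [ln k|bal k].
  have h := split_sum k (theta k * - Qred r eta nu Rm gamma k k).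
  apply: eq_has_sum (h _) => //; last by split=> //; rewrite -offE.
  by rewrite QE eqxx mul1r; ring.
have [w hw] : exists w, has_sum (fun m => if m == k then 0 else theta m * red_rate m k) w.
  by apply: has_sum_le (bal k) => // m; case: ifP.
rewrite offE hw.2; congr EFin.
have [_] := split_sum k w hw; rewrite (bal k).2 => -[E].
by rewrite QE eqxx mul1r; lra.
Qed.

(** A path of Z is projected to the environment. Arrivals and transfers keep the environment, so a
    jump that changes it must have positive [red_rate]. *)
Lemma red_rate_irreducible : irreducible_chain Zrate ->
  forall k m, clos_refl_trans K (fun a c => 0 < red_rate a c) k m.
Proof.
move=> irr k m.
suff step x y : clos_refl_trans _ (fun a c => a != c /\ 0 < Zrate a c) x y ->
    clos_refl_trans K (fun a c => 0 < red_rate a c) x.2 y.2.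
  exact: (step ([ffun=> 0%N], k) ([ffun=> 0%N], m)).
elim=> {x y} [x y [_ xy]|x|x y z _ + _]; [|exact: rt_refl|exact: rt_trans].
have [->|xy2] := eqVneq x.2 y.2; first exact: rt_refl.
apply: rt_step; rewrite lt0r red_rate_ge0 andbT; apply: contraTneq xy => red0.
have e0 j : 0 <= eta (Some j) * exit_rate x.2 j * Rm j x.2 y.2.
  by rewrite mulr_ge0 ?eta_exit_rate_ge0.
move: red0 => /eqP; rewrite paddr_eq0 ?nu_off_ge0 ?sumr_ge0// => /andP[/eqP nu0].
rewrite psumr_eq0// => /allP R0.
rewrite env_rateE nu0 (negPf xy2) !big1 ?mulr0 ?if_same ?addr0 ?ltxx// => [j _|j _|i _].
- have := R0 j (mem_index_enum j); rewrite -mulrA mulf_eq0 gt_eqF ?eta_gt0//= => /eqP ->.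
  by rewrite mulr0 if_same.
- by rewrite big1// => i _; rewrite !mulr0 if_same.
- by rewrite !mulr0 if_same.
Qed.

(** Only the factor of node [j] changes, and its normalisation appears on both sides. *)
Lemma xi_addv n j : xi eta mu (addv n j) * mu j (n j).+1 = eta (Some j) * xi eta mu n.
Proof.
have mu0 : mu j (n j).+1 != 0 by rewrite gt_eqF ?mu_gt0.
rewrite /xi (bigD1 j)//= [in RHS](bigD1 j)//= addv_id big_nat_recr//=.
rewrite (eq_bigr (fun l => (\prod_(1 <= m < (n l).+1) (eta (Some l) / mu l m))
    / Cnorm eta mu l)) => [|l /negPf lj].
  by move: (Cnorm eta mu j)^-1 => c; field.
by rewrite ffunE lj addn0.
Qed.

(** If some [Cnorm] were 0, then [xi] would vanish identically, as division by 0 gives 0, against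
    total mass 1. *)
Lemma xi_gt0 : is_distribution (xi eta mu) -> forall n, 0 < xi eta mu n.
Proof.
move=> [xi0 xi1] n; rewrite lt0r xi0 andbT; apply/prodf_neq0 => j _.
rewrite mulf_neq0//.
  rewrite gt_eqF// big_nat; apply: prodr_gt0 => l /andP[l0 _].
  by rewrite divr_gt0 ?eta_gt0 ?mu_gt0.
rewrite invr_eq0; apply/eqP => C0; move: xi1; rewrite esum1 => [/eqP|m _].
  by rewrite eq_sym onee_eq0.
by rewrite /xi (bigD1 j)//= C0 invr0 mulr0 mul0r.
Qed.

(** * The stationary distribution of Z *)

Local Notation Ztotal := (fun x => service_rate x + red_total x.2).

Lemma out_rate_env x : out_rate Zrate x = (Ztotal x)%:E.
Proof. by rewrite /out_rate esum_offdiag_diag0 ?env_rate_diag// (has_sum_env_rate x).2. Qed.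

Lemma env_stationaryP p : is_stationary Zrate p <->
  is_distribution p /\ forall x, (\tsum_y (p y * Zrate y x) = (p x * Ztotal x)%:E)%E.
Proof.
rewrite /is_stationary; split=> -[pd pb]; split=> // x; have := pb x.
  by rewrite esum_offdiag_diag0 ?env_rate_diag ?mulr0// out_rate_env => ->.
by rewrite esum_offdiag_diag0 ?env_rate_diag ?mulr0// out_rate_env => ->.
Qed.

Lemma env_reuter : non_explosive Zrate -> reuter Zrate Ztotal.
Proof.
move=> ne f f0 fb fE; apply: ne => // x.
by rewrite esum_offdiag_diag0 ?env_rate_diag ?mul0r// fE out_rate_env.
Qed.

Lemma env_stationary_product : ergodic_chain Zrate -> is_distribution (xi eta mu) ->
  exists theta : K -> R,
    [/\ is_distribution theta /\ left_null (Qred r eta nu Rm gamma) theta,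
        (forall theta', is_distribution theta' ->
           left_null (Qred r eta nu Rm gamma) theta' -> theta' = theta),
        is_stationary Zrate (fun z => xi eta mu z.1 * theta z.2)
      & (forall p, is_stationary Zrate p -> p = (fun z => xi eta mu z.1 * theta z.2))].
Proof.
move=> [_ irr ne [p pst]] xid.
have [pd pbal] := (env_stationaryP p).1 pst.
have X0 := xi_gt0 xid.
have Xge n : 0 <= xi eta mu n by exact: ltW.
have Zirr x y : clos_refl_trans _ (fun a c => 0 < Zrate a c) x y.
  elim: (irr x y) => [a c [_]|a|a b c _ h1 _ h2]; [exact: rt_step|exact: rt_refl|].
  exact: rt_trans h1 h2.
have Zsum x := (has_sum_env_rate x).2.
have prop v : subinvariant Zrate Ztotal v -> exists2 c, 0 <= c & forall x, v x = c * p x.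
  exact: (subinvariant_proportional env_rate_ge0 Zsum (env_reuter ne) Zirr pd.1 pd.2 pbal).
have eqp v : subinvariant Zrate Ztotal v -> is_distribution v -> v = p.
  move=> /prop[c c0 vE] [v0 v1]; apply/funext => x; rewrite vE.
  have : (c%:E = 1 :> \bar R)%E.
    by rewrite -v1 (eq_esum (b := fun x => (c * p x)%:E)) => [|y _]; rewrite ?vE// tsumZl ?pd.2 ?mule1//; case: pd.
  by move=> [->]; rewrite mul1r.
have prod_sum theta : (forall k, 0 <= theta k) ->
    (\tsum_x (xi eta mu x.1 * theta x.2) = \tsum_k theta k)%E.
  move=> t0; rewrite esum_pair => [|y]; last by rewrite lee_fin mulr_ge0.
  rewrite esum_exchange => [|n k]; last by rewrite lee_fin mulr_ge0.
  apply: eq_esum => k _ /=.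
  by under eq_esum do rewrite mulrC; rewrite tsumZl// xid.2 mule1.
(* Total mass 1 of [p] supplies a state; [k0] serves as the killing state and [n0] as a reference
   for cancelling [xi]. *)
have [[n0 k0] _] : exists x : {ffun 'I_J -> nat} * K, True.
  apply: contrapT => nx; move: pd.2; rewrite esum1 => [/eqP|x _].
    by rewrite eq_sym onee_eq0.
  by case: nx; exists x.
have [theta tsub to0] := exists_subinvariant red_rate_ge0
  (fun k => (has_sum_red_rate k).2) (red_rate_irreducible irr) k0.
have t0 := tsub.1.
have [c c0 tE] := prop _ (product_subinvariant Xge xi_addv t0 tsub).
have c_gt0 : 0 < c.
  rewrite lt0r c0 andbT; apply: contraTneq (mulr_gt0 (X0 n0) to0) => c_eq0.
  by have := tE (n0, k0); rewrite /= c_eq0 mul0r => ->; rewrite ltxx.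
(* With this scaling the product measure is exactly [p], and summing out the network component gives
   [th] mass 1. *)
pose th k := c^-1 * theta k.
have th0 k : 0 <= th k by rewrite mulr_ge0// invr_ge0.
have thp : (fun z => xi eta mu z.1 * th z.2) = p.
  by apply/funext => z; rewrite /th mulrCA tE mulKf ?gt_eqF.
have thd : is_distribution th.
  by split=> //; rewrite -prod_sum// -[RHS]pd.2 -thp.
(* The inflow formula at [(n0, k)] is compared with the invariance of [p]; cancelling [xi] at [n0]
   and the service term upgrades subinvariance to equality. *)
have thbal k : has_sum (fun m => th m * red_rate m k) (th k * red_total k).
  have th_le m : th m * red_rate m k <= c^-1 * (theta m * red_rate m k).
    by rewrite mulrA.
  have f0 m : 0 <= theta m * red_rate m k by rewrite mulr_ge0 ?red_rate_ge0.
  have [v hv] := tsum_bounded f0 (tsub.2 k).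
  have ci0 : 0 <= c^-1 by rewrite invr_ge0.
  have [|w hw] := has_sum_le _ th_le (has_sumZ ci0 (conj f0 hv)).
    by move=> m; rewrite mulr_ge0 ?red_rate_ge0.
  have [_] := product_inflow Xge xi_addv th0 n0 hw.
  have -> : (fun y => (xi eta mu y.1 * th y.2 * Zrate y (n0, k))%:E)
      = (fun y => (p y * Zrate y (n0, k))%:E) by apply/funext => y; rewrite -thp.
  rewrite pbal -thp /= -mulrA => -[/mulfI].
  rewrite gt_eqF// => /(_ isT); rewrite [LHS]mulrDr => /addrI wE.
  by rewrite wE.
(* Any other solution also yields a product measure equal to [p]; dividing by [xi] at [n0]
   identifies the environment factors. *)
have uniq_th t' : is_distribution t' -> left_null (Qred r eta nu Rm gamma) t' -> t' = th.
  move=> [t'0 t'1] /left_null_balance => /(_ t'0) bal.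
  have t'sub : subinvariant red_rate red_total t' by split=> // k; rewrite (bal k).2.
  have E : (fun z => xi eta mu z.1 * t' z.2) = p.
    apply: eqp; first exact: (product_subinvariant Xge xi_addv t'0 t'sub).
    by split=> [z|]; [rewrite mulr_ge0|rewrite prod_sum].
  apply/funext => k; have /(congr1 (fun f => f (n0, k))) := etrans E (esym thp).
  by move=> /= /mulfI; apply; rewrite gt_eqF.
exists th; split=> //.
- by split=> //; apply/left_null_balance.
- by rewrite thp.
- move=> p' /env_stationaryP[p'd p'bal]; rewrite thp; apply: eqp => //.
  by split=> [|x]; [exact: p'd.1|rewrite p'bal].
Qed.

End Jackson.

Unset Implicit Arguments. Set Strict Implicit. Set Printing Implicit Defensive.

Theorem theorem3p14 (R : realType) (J : nat)
  (lamj : 'I_J -> R) (mu : 'I_J -> nat -> R)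
  (r : option 'I_J -> option 'I_J -> R) (eta : option 'I_J -> R)
  (K : countType) (nu : K -> K -> R) (Rm : 'I_J -> K -> K -> R)
  (gamma : K -> 'I_J -> R) :
  (* Jackson network data *)
  (forall j, 0 <= lamj j) ->
  0 < \sum_(j : 'I_J) lamj j ->
  (forall j n, (0 < n)%N -> 0 < mu j n) ->
  (forall i j, 0 <= r i j) ->
  (forall i, \sum_(j : option 'I_J) r i j = 1) ->
  (forall i j, clos_refl_trans (option 'I_J) (fun a b => 0 < r a b) i j) ->
  (forall j, r None (Some j) = lamj j / \sum_(l : 'I_J) lamj l) ->
  r None None = 0 ->
  eta None = \sum_(j : 'I_J) lamj j ->
  (forall j, eta j = \sum_(i : option 'I_J) eta i * r i j) ->
  (* reversibility *)
  (forall i j, eta i * r i j = eta j * r j i) ->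
  (* environment: V generator, R_j stochastic, gamma(k) >= 0 *)
  (forall k m, k != m -> 0 <= nu k m) ->
  (forall k, (\esum_(m in [set m | m != k]) (nu k m)%:E = (- nu k k)%:E)%E) ->
  (forall j k m, 0 <= Rm j k m) ->
  (forall j k, (\esum_(m in [set: K]) (Rm j k m)%:E = 1)%E) ->
  (forall k j, 0 <= gamma k j) ->
  (* Z ergodic *)
  ergodic_chain (env_rate (\sum_(j : 'I_J) lamj j) r mu nu Rm gamma) ->
  (* pure Jackson network ergodic with stationary distribution xi *)
  ergodic_chain (jackson_rate (\sum_(j : 'I_J) lamj j) r mu) ->
  is_stationary (jackson_rate (\sum_(j : 'I_J) lamj j) r mu) (xi eta mu) ->
  exists theta : K -> R,
    [/\ is_distribution theta /\ left_null (Qred r eta nu Rm gamma) theta,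
        (forall theta', is_distribution theta' ->
           left_null (Qred r eta nu Rm gamma) theta' -> theta' = theta),
        is_stationary (env_rate (\sum_(j : 'I_J) lamj j) r mu nu Rm gamma)
          (fun z => xi eta mu z.1 * theta z.2)
      & (forall p, is_stationary (env_rate (\sum_(j : 'I_J) lamj j) r mu nu Rm gamma) p ->
           p = (fun z => xi eta mu z.1 * theta z.2))].
Proof.
move=> _ lam0 mu0 r0 _ rirr _ _ eta0 _ etarev nu0 nusum Rm0 Rmsum gamma0 erg _ [xid _].
exact: (env_stationary_product lam0 mu0 r0 rirr eta0 etarev nu0 nusum Rm0 Rmsum gamma0).
Qed.
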